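(* Let $\mathbb{K}$ be an algebraically closed field of characteristic zero, let $R$ be a local algebra over $\mathbb{K}$ of dimension $n+2$ with maximal ideal $\mathfrak{m}$, and let $F$ be a non-degenerate bilinear symmetric form on $R$ such that $F(1,1)=0$. Assume that $W$ is a hyperplane in $\mathfrak{m}$ which generates $R$ as an algebra with unit and satisfies $$F(ab_1,b_2)+F(b_1,ab_2)=0\quad\text{for all } b_1,b_2\in R,\ a\in W.$$ Then there is a basis $e_0=1,e_1,\ldots,e_n,e_{n+1}$ of $R$ with $W=\langle e_1,\ldots,e_n\rangle$ and $\mathfrak{m}=\langle e_1,\ldots,e_{n+1}\rangle$ such that $$R=\mathbb{K}[e_1,\ldots,e_n]/(e_i^2-e_j^2,\ e_ie_j;\ 1\le i<j\le n)$$ if $n\ge2$, and $R=\mathbb{K}[e_1]/(e_1^3)$ if $n=1$, and such that the matrix of $F$ in the basis $e_0,\ldots,e_{n+1}$ is $$M(F)=\begin{pmatrix}0&0&\ldots&0&1\\0&-1&\ldots&0&0\\\vdots&\vdots&\ddots&\vdots&\vdots\\0&0&\ldots&-1&0\\1&0&\ldots&0&0\end{pmatrix},$$ i.e. $F(e_0,e_{n+1})=F(e_{n+1},e_0)=1$, $F(e_i,e_i)=-1$ for $1\le i\le n$, and all other values $F(e_i,e_j)$ are zero.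
   Context: A local algebra is a finite-dimensional commutative associative local $\mathbb{K}$-algebra with unit. A hyperplane in $\mathfrak{m}$ is a linear subspace of codimension one. The displayed presentation of $R$ means that the homomorphism from the polynomial algebra in $n$ variables to $R$ sending the $i$-th variable to the basis element $e_i$ is surjective with kernel generated by the listed relations. *)

(* Defs.v *)
From mathcomp Require Import all_boot all_order all_algebra all_field.
From mathcomp Require Import mpoly.

Set Implicit Arguments.
Unset Strict Implicit.
Unset Printing Implicit Defensive.

Import GRing.Theory.
Local Open Scope ring_scope.

Section LocalAlgebra.
Context {K : fieldType} {R : falgType K}.
Implicit Types I M m W : {vspace R}.

(* For commutative algebras, so left ideals are enough; every ideal of an
   algebra with unit is a linear subspace, hence the use of {vspace R}. *)
Definition is_ideal I : Prop :=
  forall a x : R, x \in I -> a * x \in I.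

Definition maximal_ideal M : Prop :=
  [/\ is_ideal M, M <> fullv
    & forall I, is_ideal I -> (M <= I)%VS -> I = M \/ I = fullv].

Definition local_with_maximal_ideal m : Prop :=
  maximal_ideal m /\ (forall M, maximal_ideal M -> M = m).

Definition hyperplane_in W m : Prop :=
  (W <= m)%VS /\ (\dim W).+1 = \dim m.

End LocalAlgebra.

Definition ideal_generated (A : comNzRingType) (S : A -> Prop) (x : A) : Prop :=
  exists (k : nat) (c r : 'I_k -> A),
    (forall i, S (r i)) /\ x = \sum_(i < k) c i * r i.

Section Presentation.
Context {K : fieldType} {R : falgType K} {n : nat}.

(* mmap (in_alg R) e is multiplicative as soon as the e i commute. *)
Definition poly_eval (e : 'I_n -> R) (p : {mpoly K[n]}) : R :=
  mmap (in_alg R) e p.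

Definition presented_by (e : 'I_n -> R) (rels : {mpoly K[n]} -> Prop) : Prop :=
  (forall x : R, exists p : {mpoly K[n]}, poly_eval e p = x) /\
  (forall p : {mpoly K[n]}, poly_eval e p = 0 <-> ideal_generated rels p).

End Presentation.

Definition quadratic_rels (K : fieldType) (n : nat) (p : {mpoly K[n]}) : Prop :=
  exists i j : 'I_n,
    (i < j)%N /\ (p = 'X_i ^+ 2 - 'X_j ^+ 2 \/ p = 'X_i * 'X_j).

(* Used for n = 1 only, where 'X_i ranges over the single variable. *)
Definition cubic_rels (K : fieldType) (n : nat) (p : {mpoly K[n]}) : Prop :=
  exists i : 'I_n, p = 'X_i ^+ 3.

Definition standard_form_mx (K : fieldType) (n : nat) : 'M[K]_n.+2 :=
  \matrix_(i, j)
    if ((i == 0 :> nat) && (j == n.+1 :> nat)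
        || (i == n.+1 :> nat) && (j == 0 :> nat))%N then 1
    else if (i == j) && (0 < i < n.+1)%N then -1
    else 0.

(* Main.v *)
(* Let phi x = F(1, x).  Elements of W are skew-adjoint for F, so phi vanishes
   on products of an odd number of elements of W, while products of two elements
   of W are self-adjoint.  Since W generates R, R = K 1 + m and W is the kernel
   of phi on m.  A self-adjoint element of W is 0 by non-degeneracy; hence all
   self-adjoint elements of m lie on one line, spanned by some s with
   phi(s) = 1, and a b = phi(a b) s = - F(a, b) s for a, b in W.  Locality of R
   forces s^2 = 0 and then W s = 0, so F pairs 1 with s and is non-degenerate on
   W.  An orthogonal basis e_1, ..., e_n of W with F(e_i, e_i) = -1, completed by
   e_0 = 1 and e_{n+1} = s, is the required one.  The kernel of the evaluation at
   e_1, ..., e_n is computed by reducing polynomials to the linear span of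
   1, X_1, ..., X_n, X_1^2. *)

From HB Require Import structures.
Require Import Defs.
From mathcomp Require Import all_boot all_order all_algebra all_field.
From mathcomp Require Import mpoly ring.

Import GRing.Theory.
Local Open Scope ring_scope.

(** * Closure properties of the ideal generated by a set *)

Section IdealGenerated.
Context {A : comNzRingType} (S : A -> Prop).

Lemma ideal_generated_mem x : S x -> ideal_generated S x.
Proof.
move=> Sx; exists 1%N, (fun=> 1), (fun=> x).
by split=> // ; rewrite big_ord1 mul1r.
Qed.

Lemma ideal_generatedM a x : ideal_generated S x -> ideal_generated S (a * x).
Proof.
case=> k [c [r [Sr ->]]]; exists k, (fun i => a * c i), r; split=> //.
by rewrite mulr_sumr; apply: eq_bigr => i _; rewrite mulrA.
Qed.

Lemma ideal_generated0 : ideal_generated S 0.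
Proof.
exists 0%N, (fun=> 0), (fun=> 0); split; first by case.
by rewrite big_ord0.
Qed.

Lemma ideal_generatedD x y :
  ideal_generated S x -> ideal_generated S y -> ideal_generated S (x + y).
Proof.
case=> k [c [r [Sr ->]]] [l [d [t [St ->]]]].
pose glue (f : 'I_k -> A) (g : 'I_l -> A) (i : 'I_(k + l)) :=
  match split i with inl j => f j | inr j => g j end.
exists (k + l)%N, (glue c d), (glue r t); split.
  by rewrite /glue => i; case: split.
rewrite big_split_ord /=; congr (_ + _); apply: eq_bigr => i _; rewrite /glue.
  by rewrite (unsplitK (inl _ i)).
by rewrite (unsplitK (inr _ i)).
Qed.

Lemma ideal_generatedN x : ideal_generated S x -> ideal_generated S (- x).
Proof. by rewrite -mulN1r; apply: ideal_generatedM. Qed.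

Lemma ideal_generated_sum (I : finType) (f : I -> A) :
  (forall i, ideal_generated S (f i)) -> ideal_generated S (\sum_i f i).
Proof.
move=> Sf; elim/big_ind: _ => //; first exact: ideal_generated0.
exact: ideal_generatedD.
Qed.

End IdealGenerated.

(** * Presentations obtained from a linear section of the evaluation map *)

Section LinearSection.
Context {K : fieldType} {R : falgType K} {n : nat}.
Hypothesis R_comm : commutative (@GRing.mul R).
Variable e : 'I_n -> R.

Lemma poly_evalM p q : poly_eval e (p * q) = poly_eval e p * poly_eval e q.
Proof.
rewrite /poly_eval; have [-> //] : multiplicative (mmap (in_alg R) e).
by apply: commr_mmap_is_multiplicative => *; apply: R_comm.
Qed.

Lemma poly_eval_linear : linear (poly_eval e).
Proof. by move=> c p q; rewrite /poly_eval mmapD mmapZ /= mulr_algl. Qed.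

Lemma poly_eval1 : poly_eval e 1 = 1.
Proof. by rewrite /poly_eval mmapC /= scale1r. Qed.

Lemma poly_evalX i : poly_eval e 'X_i = e i.
Proof. by rewrite /poly_eval mmapX mmap1U. Qed.

HB.instance Definition _ :=
  GRing.isLinear.Build K {mpoly K[n]} R _ (poly_eval e) poly_eval_linear.

(* The last two hypotheses say that, modulo rels, every polynomial p reduces
   to L (p(e)). *)
Lemma presented_by_linear_section
    (rels : {mpoly K[n]} -> Prop) (L : {linear R -> {mpoly K[n]}}) :
  cancel L (poly_eval e) ->
  (forall p, rels p -> poly_eval e p = 0) ->
  ideal_generated rels (1 - L 1) ->
  (forall i x, ideal_generated rels ('X_i * L x - L (e i * x))) ->
  presented_by e rels.
Proof.
move=> LK rels0 I1 IX; split=> [x|p]; first by exists (L x).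
split=> [p0|[k [c [r [Sr ->]]]]]; last first.
  rewrite linear_sum big1 //= => i _.
  by rewrite poly_evalM (rels0 (r i)) ?mulr0.
(* [T p] says that [p] is congruent to [L (poly_eval e p)]. It is proved for monomials, one variable
   factor at a time, and then extended by linearity. *)
pose T p := ideal_generated rels (p - L (poly_eval e p)).
suff: T p by rewrite /T p0 linear0 subr0.
have TX (mm : 'X_{1..n}) : T 'X_[mm].
  suff Tmul q : T q -> T ('X_[K, mm] * q).
    by rewrite -['X_[_]]mulr1; apply: Tmul; rewrite /T poly_eval1.
  rewrite mpolyXE_id; elim/big_rec: _ q => [q|i p' _ IH q Tq].
    by rewrite mul1r.
  rewrite -mulrA; elim: (mm i) => [|j IHj]; first by rewrite mul1r; apply: IH.
  rewrite exprS -mulrA /T; set u := _ * (p' * q) in IHj *.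
  rewrite poly_evalM poly_evalX.
  (* Multiplication by a variable costs two errors: the old one times ['X_i], and the failure of [L]
     to commute with multiplication by [e i]. *)
  have -> : 'X_i * u - L (e i * poly_eval e u) =
    'X_i * (u - L (poly_eval e u))
     + ('X_i * L (poly_eval e u) - L (e i * poly_eval e u)).
    by rewrite mulrBr addrA subrK.
  by apply: ideal_generatedD => //; apply: ideal_generatedM.
elim/mpolyind: p {p0} => [|c mm p _ _ Tp].
  by rewrite /T !linear0 addr0; apply: ideal_generated0.
rewrite /T linearP linearP /= opprD addrACA -scalerBr.
apply: ideal_generatedD => //; rewrite -mul_mpolyC.
by apply: ideal_generatedM; apply: TX.
Qed.

End LinearSection.

(** * Presentation of an algebra with the multiplication table of a quadric *)

Section QuadricPresentation.
Context {K : fieldType} {R : falgType K} {n : nat}.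
Hypothesis R_comm : commutative (@GRing.mul R).
Variables (F : {symmetric R}) (e : 'I_n -> R) (s : R).
Hypothesis F_inv : forall i x y, F (e i * x) y + F x (e i * y) = 0.
Hypothesis F_expand :
  forall x, x = F x s *: 1 - \sum_i F x (e i) *: e i + F x 1 *: s.
Hypothesis mulee : forall i j, e i * e j = s *+ (i == j).
Hypothesis mules : forall i, e i * s = 0.
Hypothesis F1 : forall i, F 1 (e i) = 0.
Hypothesis F1s : F 1 s = 1.
Hypothesis F11 : F 1 1 = 0.

(** By [F_expand], the family [s], [- e i], 1 is dual to 1, [e i], [s]. Replacing [s] by [P] in this
    expansion gives the linear section [L]. The two ideal hypotheses mirror [mulee] and [mules], so
    multiplication by a variable commutes with [L] modulo [rels]. *)
Lemma presented_by_quadric (rels : {mpoly K[n]} -> Prop) (P : {mpoly K[n]}) :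
  poly_eval e P = s ->
  (forall p, rels p -> poly_eval e p = 0) ->
  (forall i j, ideal_generated rels ('X_i * 'X_j - P *+ (i == j))) ->
  (forall i, ideal_generated rels ('X_i * P)) ->
  presented_by e rels.
Proof.
move=> eP rels0 IXX IXP.
pose L x : {mpoly K[n]} :=
  F x s *: 1 - \sum_i F x (e i) *: 'X_i + F x 1 *: P.
have L_linear : linear L.
  move=> c x y; rewrite /L !linearPl /=.
  under eq_bigr do rewrite linearPl scalerDl -scalerA.
  rewrite big_split /= -scaler_sumr -!mul_mpolyC !mpolyCD !mpolyCM.
  by ring.
pose LL := HB.pack_for {linear R -> {mpoly K[n]}} L
  (GRing.isLinear.Build K R {mpoly K[n]} _ L L_linear).
apply: (@presented_by_linear_section K R n R_comm e rels LL) => [x|//||i x].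
- rewrite /= /L linearD linearB !linearZ (linear_sum (poly_eval e)) /=.
  rewrite eP poly_eval1 [RHS]F_expand.
  by under eq_bigr do rewrite linearZ /= poly_evalX.
- rewrite /= /L F1s F11 scale1r scale0r addr0 big1 => [|j _].
    by rewrite subr0 subrr; apply: ideal_generated0.
  by rewrite F1 scale0r.
(* Invariance moves [e i] to the other argument, so the coordinates of [e i * x] can be read off the
   multiplication table. *)
have Fe y : F (e i * x) y = - F x (e i * y).
  by apply/eqP; rewrite -addr_eq0 F_inv.
have Fes : F (e i * x) s = 0 by rewrite Fe mules linear0r oppr0.
have Fee j : F (e i * x) (e j) = - (F x s *+ (i == j)).
  by rewrite Fe mulee linearMnr.
have -> : 'X_i * LL x - LL (e i * x) =
    F x 1 *: ('X_i * P) - \sum_j F x (e j) *: ('X_i * 'X_j - P *+ (i == j)).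
  rewrite /= /L Fes Fe mulr1 scale0r add0r.
  have -> : \sum_j F (e i * x) (e j) *: 'X_j = - F x s *: 'X_i :> {mpoly K[n]}.
    rewrite (bigD1 i) //= Fee eqxx big1 ?addr0 // => j ne_ji.
    by rewrite Fee eq_sym (negPf ne_ji) oppr0 scale0r.
  under [in RHS]eq_bigr do rewrite scalerBr scalerAr.
  rewrite sumrB -mulr_sumr.
  have -> : \sum_j F x (e j) *: (P *+ (i == j)) = F x (e i) *: P.
    rewrite (bigD1 i) //= eqxx big1 ?addr0 // => j ne_ji.
    by rewrite eq_sym (negPf ne_ji) scaler0.
  by rewrite !scaleNr -!mul_mpolyC; ring.
apply: ideal_generatedD; first by rewrite -mul_mpolyC; apply: ideal_generatedM.
apply: ideal_generatedN; apply: ideal_generated_sum => j.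
by rewrite -mul_mpolyC; apply: ideal_generatedM.
Qed.

End QuadricPresentation.

(** * Symmetric bilinear forms and orthogonal bases *)

Section SymmetricForm.
Context {K : fieldType} {V : vectType K}.
Variable F : {symmetric V}.
Implicit Types (x y : V) (U : {vspace V}).

Lemma symmetric_formC x y : F x y = F y x.
Proof. by rewrite hermC /= expr0 mul1r. Qed.

(** Polarization: if [u] and [v] are isotropic and [F u v] is nonzero, then [u + v] has norm twice
    [F u v]. *)
Lemma exists_nonisotropic U : (2%:R : K) != 0 ->
  (U :&: orthov F U)%VS = 0%VS -> U != 0%VS -> exists2 w, w \in U & F w w != 0.
Proof.
move=> nz2 Und nzU.
have /subvPn[u Uu /mem_orthovPn[v Uv nzuv]] : ~~ (U <= orthov F U)%VS.
  by apply: contra nzU => /capv_idPl <-; rewrite Und.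
have [Fu|nzu] := eqVneq (F u u) 0; last by exists u.
have [Fv|nzv] := eqVneq (F v v) 0; last by exists v.
exists (u + v); first exact: rpredD.
by rewrite hnormD Fu Fv /= expr0 mul1r !add0r -mulr2n -mulr_natl mulf_neq0.
Qed.

End SymmetricForm.

Lemma closed_field_sqrt (K : closedFieldType) (c : K) : exists z, z ^+ 2 = c.
Proof.
have [z] := @solve_monicpoly K 2 (fun i => if i is 0%N then c else 0) isT.
by rewrite !big_ord_recl big_ord0 /= mulr1 mul0r !addr0 => <-; exists z.
Qed.

(** Gram-Schmidt by induction on the dimension: rescale a nonisotropic vector by a square root to
    give it norm [c], then pass to its orthogonal complement in [U]. *)
Lemma orthogonal_basis_exists (K : closedFieldType) (V : vectType K)
    (F : {symmetric V}) (U : {vspace V}) (c : K) :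
  (2%:R : K) != 0 -> c != 0 -> (U :&: orthov F U)%VS = 0%VS ->
  exists2 s : seq V, basis_of U s &
    {in gtn (size s) &, forall i j, F s`_i s`_j = c *+ (i == j)}.
Proof.
move=> nz2 nzc; move: {2}(\dim U) (erefl (\dim U)) => d.
elim: d U => [|d IHd] U dimU Und.
  move/eqP: dimU; rewrite dimv_eq0 => /eqP ->.
  by exists [::]; rewrite ?nil_basis // => i j; rewrite inE ltn0.
have nzU : U != 0%VS by rewrite -dimv_eq0 dimU.
have [w0 Uw0 nzw0] := exists_nonisotropic F U nz2 Und nzU.
have [t Ht] := closed_field_sqrt K (c / F w0 w0).
pose w := t *: w0.
have Uw : w \in U by rewrite rpredZ.
have Fww : F w w = c.
  by rewrite linearZl_LR linearZr_LR /= mulrA -expr2 Ht divfK.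
pose U' := (U :&: orthov F <[w]>)%VS.
have dimU' : \dim U' = d.
  rewrite /U' -eq_dim_orthov1 ?dimU //; apply/mem_orthovPn.
  by exists w; rewrite // Fww.
(* Removing the projection onto [w] lands in the complement [U']. *)
have decU u : u \in U -> u - (F u w / c) *: w \in U'.
  move=> Uu; rewrite memv_cap rpredB ?rpredZ //= mem_orthov1.
  by rewrite linearBl /= linearZl_LR /= Fww divfK // subrr.
have [||s bs Fs] := IHd U'; first exact: dimU'.
  (* The form stays non-degenerate on [U']: a vector of [U'] orthogonal to [U'] is also orthogonal
     to [w], hence to all of [U]. *)
  apply/eqP; rewrite -subv0; apply/subvP => x; rewrite memv_cap.
  case/andP; rewrite {1}memv_cap mem_orthov1.
  move=> /andP[Ux /eqP xw] /mem_orthovP xU'.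
  rewrite -Und memv_cap Ux; apply/mem_orthovP => u Uu.
  rewrite -(subrK ((F u w / c) *: w) u) linearDr /= xU' ?decU //.
  by rewrite linearZr_LR /= xw mulr0 addr0.
have sz : size s = d by case/andP: bs => /eqP ss /eqP <-; rewrite ss.
exists (w :: s).
  rewrite basisEdim /= sz dimU ltnSn andbT; apply/subvP => u Uu.
  rewrite -(subrK ((F u w / c) *: w) u) span_cons addrC memv_add //.
    by rewrite rpredZ ?memv_line.
  by rewrite (span_basis bs) decU.
have ws i : (i < size s)%N -> F s`_i w = 0.
  move=> lti; have := basis_mem bs (mem_nth 0 lti).
  by rewrite memv_cap mem_orthov1 => /andP[_ /eqP].
case=> [|i] [|j] //=; rewrite !inE ?ltnS ?eqSS.
- by move=> _ /ws; rewrite symmetric_formC.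
- by move=> /ws.
- exact: Fs.
Qed.

(** * Structure of a local algebra with an invariant form *)

Section InvariantForm.
Context {K : fieldType} {R : falgType K}.
Hypothesis nz2 : (2%:R : K) != 0.
Hypothesis R_comm : commutative (@GRing.mul R).
Context {m W : {vspace R}} {F : {symmetric R}}.
Hypothesis localR : local_with_maximal_ideal m.
Hypotheses (F_nondeg : nondegenerate F) (F11 : F 1 1 = 0).
Hypotheses (W_hyper : hyperplane_in W m) (W_gen : agenv W = fullv).
Hypothesis F_inv :
  forall a b1 b2 : R, a \in W -> F (a * b1) b2 + F b1 (a * b2) = 0.

Lemma nondegenerate_eq0 x : (forall y, F x y = 0) -> x = 0.
Proof.
move=> Fx; apply/eqP; rewrite -memv0 -(eqP F_nondeg).
by apply/mem_orthovP => y _.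
Qed.

Lemma eq_oppr_eq0 (c : K) : c = - c -> c = 0.
Proof.
move/eqP; rewrite -addr_eq0 -mulr2n -mulr_natl mulf_eq0 (negPf nz2) /=.
by move/eqP.
Qed.

Lemma invariant_formMl a x y : a \in W -> F (a * x) y = - F x (a * y).
Proof. by move=> Wa; apply/eqP; rewrite -addr_eq0 F_inv. Qed.

(** Skew-adjointness and symmetry make this value its own opposite. *)
Lemma invariant_form_hyperplane a : a \in W -> F 1 a = 0.
Proof.
move=> Wa; apply: eq_oppr_eq0.
by rewrite -{2}[a]mulr1 -invariant_formMl // mulr1 symmetric_formC.
Qed.

Lemma invariant_formE a x : a \in W -> F a x = - F 1 (a * x).
Proof. by move=> Wa; rewrite -{1}[a]mulr1 invariant_formMl. Qed.

Lemma hyperplane_sub : {subset W <= m}.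
Proof. by apply/subvP; case: W_hyper. Qed.

Lemma maximal_idealM x y : y \in m -> x * y \in m.
Proof. by case: localR => -[mI _ _] _; apply: mI. Qed.

Lemma one_notin_maximal : 1 \notin m.
Proof.
apply/negP => m1; case: localR => -[_ + _] _; apply.
by apply/vspaceP => x; rewrite memvf -[x]mulr1 maximal_idealM.
Qed.

(* A proper ideal not contained in m, of largest dimension, would be a
   second maximal ideal. *)
Lemma proper_ideal_sub I : is_ideal I -> I != fullv -> (I <= m)%VS.
Proof.
(* Induction on the codimension: a proper ideal strictly above [I] lies in [m] already, and would
   force [I] into [m]. *)
have [k] := ubnP (\dim {:R} - \dim I); elim: k I => // k IHk I ltk II nIf.
apply/negPn/negP => nIm; suff II_max : maximal_ideal I.
  by case: localR => _ /(_ I II_max) eIm; rewrite eIm subvv in nIm.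
split=> // [|J JI sIJ]; first exact/eqP.
have [->|neJI] := eqVneq J I; first by left.
have [->|nJf] := eqVneq J fullv; first by right.
have ltIJ : (\dim I < \dim J)%N.
  by rewrite ltnNge; apply: contra neJI => leJI; rewrite eq_sym eqEdim sIJ.
case/negP: nIm; apply: (subv_trans sIJ); apply: IHk => //.
have := dimvS (subvf J) => /(leq_trans ltIJ) ltIf.
by apply: leq_trans (ltn_sub2l ltIf ltIJ) _; rewrite -ltnS.
Qed.

(** The space [1 + m] contains 1 and is stable under multiplication by [W], so it contains the
    algebra generated by [W]. *)
Lemma fullv_add1_maximal : fullv = (1 + m)%VS.
Proof.
apply/eqP; rewrite eqEsubv subvf andbT -W_gen agenv_sub_modl ?addvSl //.
apply: subv_trans (addvSr _ _); apply/prodvP => a x Wa _.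
by rewrite R_comm maximal_idealM // hyperplane_sub.
Qed.

(** If 1 were orthogonal to [m], it would be orthogonal to all of [R], because [F 1 1 = 0]. So the
    orthogonal of 1 cuts [m] in codimension one; it contains [W], and dimensions agree. *)
Lemma hyperplaneE : W = (m :&: orthov F <[1]>)%VS.
Proof.
case: W_hyper => sWm dimW.
have nm1 : 1 \notin orthov F m.
  apply/negP => /mem_orthovP m1; case/eqP: (oner_neq0 R).
  apply: nondegenerate_eq0 => y; have := memvf y.
  rewrite fullv_add1_maximal => /memv_addP[_ /vlineP[c ->] [z mz ->]].
  by rewrite linearDr linearZr_LR /= F11 m1 // mulr0 addr0.
apply/eqP; rewrite eqEdim -eq_dim_orthov1 // -dimW leqnn andbT.
apply/subvP => a Wa; rewrite memv_cap hyperplane_sub // mem_orthov1.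
by rewrite symmetric_formC invariant_form_hyperplane ?eqxx.
Qed.

Lemma mem_hyperplane x : x \in m -> F 1 x = 0 -> x \in W.
Proof.
move=> mx F1x.
by rewrite hyperplaneE memv_cap mx mem_orthov1 symmetric_formC F1x eqxx.
Qed.

Definition self_adjoint x := forall y z, F (x * y) z = F y (x * z).

Lemma self_adjointM a b : a \in W -> b \in W -> self_adjoint (a * b).
Proof.
move=> Wa Wb y z; rewrite -mulrA !invariant_formMl // opprK.
by rewrite mulrA (R_comm b).
Qed.

(** Such an [x] is both self-adjoint and skew-adjoint, so [F x z = - F x z] for every [z]. *)
Lemma self_adjoint_hyperplane x : x \in W -> self_adjoint x -> x = 0.
Proof.
move=> Wx adjx; apply: nondegenerate_eq0 => z; apply: eq_oppr_eq0.
by rewrite {1}(invariant_formE x z Wx) -adjx mulr1.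
Qed.

Lemma dim_fullv_maximal : \dim {:R} = (\dim m).+1.
Proof.
rewrite fullv_add1_maximal dimv_disjoint_sum ?dimv1 //.
apply/eqP; rewrite -subv0; apply/subvP => x; rewrite memv_cap.
case/andP=> /vlineP[c ->]; have [->|nzc] := eqVneq c 0.
  by rewrite scale0r !mem0v.
move/(rpredZ c^-1); rewrite scalerA mulVf // scale1r.
by rewrite (negPf one_notin_maximal).
Qed.

Lemma dim_add1_hyperplane : (\dim (1 + W) < \dim {:R})%N.
Proof.
rewrite dim_fullv_maximal -(proj2 W_hyper) ltnS.
by have [] := dimv_add_leqif 1%VS W; rewrite dimv1.
Qed.

(** If [F] vanished on pairs from [W], every product of two elements of [W] would be a self-adjoint
    element of [W], hence 0. Then [1 + W] would be a subalgebra containing the generators, although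
    its dimension is too small. *)
Lemma hyperplane_product_neq0 :
  exists a b, [/\ a \in W, b \in W & F 1 (a * b) != 0].
Proof.
have /subvPn[a Wa /mem_orthovPn[b Wb Fab]] : ~~ (W <= orthov F W)%VS.
  apply/negP => /subvP W0; have := dim_add1_hyperplane.
  rewrite ltnNge => /negP; apply; apply: dimvS.
  rewrite -W_gen agenv_sub_modl ?addvSl // prodvDr prodv1 subv_add addvSr.
  apply/prodvP => a b Wa Wb; suff -> : a * b = 0 by rewrite mem0v.
  have /mem_orthovP Fa := W0 a Wa; have mab : a * b \in m.
    by rewrite maximal_idealM // hyperplane_sub.
  apply: (self_adjoint_hyperplane _ _ (self_adjointM _ _ Wa Wb)).
  apply: mem_hyperplane => //.
  by rewrite -[F _ _]opprK -invariant_formE // Fa ?oppr0.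
by exists a, b; split=> //; rewrite -oppr_eq0 -invariant_formE.
Qed.

Lemma maximal_decomposition s :
  s \in m -> F 1 s = 1 -> m = (W + <[s]>)%VS.
Proof.
move=> ms F1s; apply/eqP; rewrite eqEsubv; apply/andP; split.
  apply/subvP => z mz; rewrite -(subrK (F 1 z *: s) z).
  apply: memv_add; last by rewrite rpredZ ?memv_line.
  apply: mem_hyperplane; first by apply: rpredB => //; apply: rpredZ.
  by rewrite linearBr linearZr_LR /= F1s mulr1 subrr.
by rewrite subv_add -memvE ms andbT; apply/subvP/hyperplane_sub.
Qed.

(** Non-degeneracy only has to be tested on 1, [W] and [s], which together span [R]. *)
Lemma orthogonal_generators_eq0 s x : s \in m -> F 1 s = 1 ->
  F x 1 = 0 -> {in W, forall a, F x a = 0} -> F x s = 0 -> x = 0.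
Proof.
move=> ms F1s Fx1 FxW Fxs; apply: nondegenerate_eq0 => y; have := memvf y.
rewrite fullv_add1_maximal (maximal_decomposition s ms F1s).
case/memv_addP=> _ /vlineP[c ->] [_ /memv_addP[a Wa [_ /vlineP[d ->] ->]] ->].
by rewrite !linearDr !linearZr_LR /= Fx1 Fxs FxW // !mulr0 !addr0.
Qed.

(** These properties fix the multiplication table of [R], with [s] annihilated by the generators. *)
Lemma socle_generator : exists s,
  [/\ s \in m, F 1 s = 1, F s s = 0,
      forall a b, a \in W -> b \in W -> a * b = - F a b *: s
    & forall a, a \in W -> a * s = 0].
Proof.
have [a0 [b0 [Wa0 Wb0 nz0]]] := hyperplane_product_neq0.
set c0 := F 1 (a0 * b0) in nz0.
pose s := c0^-1 *: (a0 * b0).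
have ms : s \in m by rewrite rpredZ ?maximal_idealM ?hyperplane_sub.
have F1s : F 1 s = 1 by rewrite linearZr_LR /= mulVf.
have nzs : s != 0.
  by apply: contra_eq_neq F1s => ->; rewrite linear0r eq_sym oner_eq0.
have adjs : self_adjoint s.
  move=> y z; rewrite -!scalerAl linearZl_LR linearZr_LR /=.
  by rewrite (self_adjointM _ _ Wa0 Wb0).
clearbody s.
(* The difference [x - F 1 x *: s] is self-adjoint and lies in the kernel of [F 1] on [m], which is
   [W]; so it is 0. *)
have adjE x : x \in m -> self_adjoint x -> x = F 1 x *: s.
  move=> mx adjx; apply/eqP; rewrite -subr_eq0; apply/eqP.
  apply: self_adjoint_hyperplane.
    apply: mem_hyperplane; first by apply: rpredB => //; apply: rpredZ.
    by rewrite linearBr linearZr_LR /= F1s mulr1 subrr.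
  move=> y z; rewrite !mulrBl -!scalerAl linearBl linearBr /=.
  by rewrite linearZl_LR linearZr_LR /= adjx adjs.
have mulW a b : a \in W -> b \in W -> a * b = - F a b *: s.
  move=> Wa Wb; rewrite invariant_formE // opprK; apply: adjE.
    by rewrite maximal_idealM ?hyperplane_sub.
  exact: self_adjointM.
have s2 : s * s = 0.
  set l := F 1 (s * s).
  have ss : s * s = l *: s.
    apply: adjE; first exact: maximal_idealM.
    by move=> y z; rewrite -mulrA !adjs mulrA.
  have [l0|nzl] := eqVneq l 0; first by rewrite ss l0 scale0r.
  (* If [l] were nonzero, [t] would lie in the annihilator of [s], a proper ideal and so contained
     in [m]. Then [s - t], a nonzero scalar, would lie in [m] as well. *)
  pose t := s - l%:A.
  have st : s * t = 0 by rewrite mulrBr ss mulr_algr subrr.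
  have mt : t \in m.
    have /subvP : (lker (amull s) <= m)%VS.
      apply: proper_ideal_sub => [x y|].
        rewrite !memv_ker !lfunE /= => /eqP sy.
        by rewrite mulrA (R_comm s) -mulrA sy mulr0.
      apply: contraNneq nzs => ann_full.
      by have := memvf (1 : R); rewrite -ann_full memv_ker lfunE /= mulr1.
    by apply; rewrite memv_ker lfunE /= st.
  case/negP: one_notin_maximal.
  have -> : 1 = l^-1 *: (s - t).
    by rewrite opprB addrC subrK scalerA mulVf ?scale1r.
  by apply/rpredZ/rpredB.
have Fss : F s s = 0 by rewrite -{1}[s]mulr1 adjs s2 linear0r.
exists s; split=> // a Wa.
(* Moving [a] across changes the sign of [F 1 (a * s)], moving [s] across does not. *)
have Was : a * s \in W.
  apply: mem_hyperplane; first exact: maximal_idealM.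
  apply: eq_oppr_eq0; rewrite -[in RHS]invariant_formMl // mulr1.
  by rewrite R_comm -adjs mulr1 symmetric_formC.
(* The product [b * a] is a multiple of [s], so [b * a * s] vanishes with [s * s]. *)
have Fsa b : b \in W -> F (a * s) b = 0.
  move=> Wb; rewrite symmetric_formC invariant_formE // mulrA (mulW b a) //.
  by rewrite -scalerAl s2 scaler0 linear0r oppr0.
apply: (orthogonal_generators_eq0 s) => //.
  by rewrite symmetric_formC invariant_form_hyperplane.
by rewrite R_comm adjs s2 linear0r.
Qed.

End InvariantForm.

(** * Consequences of the quadratic relations *)

Section QuadraticRels.
Context {K : fieldType} {n : nat}.
Local Notation I := (ideal_generated (@quadratic_rels K n)).

Lemma quadratic_relsM (i j : 'I_n) : i != j -> I ('X_i * 'X_j).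
Proof.
rewrite -val_eqE neq_ltn => /orP[] lt; last rewrite mulrC.
  by apply: ideal_generated_mem; exists i, j; split=> //; right.
by apply: ideal_generated_mem; exists j, i; split=> //; right.
Qed.

Lemma quadratic_relsB (i j : 'I_n) : I ('X_i ^+ 2 - 'X_j ^+ 2).
Proof.
have [ltij|ltji|/val_inj ->] := ltngtP i j.
- by apply: ideal_generated_mem; exists i, j; split=> //; left.
- rewrite -opprB; apply: ideal_generatedN.
  by apply: ideal_generated_mem; exists j, i; split=> //; left.
by rewrite subrr; apply: ideal_generated0.
Qed.

(** The auxiliary index [k] is what requires two variables: modulo the relations the cube of ['X_j]
    becomes ['X_j * 'X_k ^+ 2], a multiple of ['X_j * 'X_k]. *)
Lemma quadratic_rels_cube (i j k : 'I_n) : j != k -> I ('X_i * 'X_j ^+ 2).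
Proof.
move=> nejk; have [->|neij] := eqVneq i j; last first.
  by rewrite expr2 mulrA mulrC; apply/ideal_generatedM/quadratic_relsM.
have -> : 'X_j * 'X_j ^+ 2 =
  'X_j * ('X_j ^+ 2 - 'X_k ^+ 2) + 'X_k * ('X_j * 'X_k) :> {mpoly K[n]}.
  by ring.
apply: ideal_generatedD; apply: ideal_generatedM; first exact: quadratic_relsB.
exact: quadratic_relsM.
Qed.

End QuadraticRels.

(** * Construction of the basis, the presentations and the matrix of the form *)

Theorem proposition6 (K : closedFieldType) (charK0 : [pchar K] =i pred0)
    (n : nat) (R : falgType K)
    (R_comm : commutative (@GRing.mul R)) (dimR : \dim {:R} = n.+2)
    (m : {vspace R}) (localR : local_with_maximal_ideal m)
    (F : {symmetric R}) (F_nondeg : nondegenerate F) (F11 : F 1 1 = 0)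
    (W : {vspace R}) (W_hyper : hyperplane_in W m)
    (W_gen : agenv W = fullv)
    (F_inv : forall a b1 b2 : R, a \in W -> F (a * b1) b2 + F b1 (a * b2) = 0) :
  exists e : n.+2.-tuple R,
    [/\ basis_of {:R} e,
        e`_0 = 1,
        W = <<[seq e`_i | i <- iota 1 n]>>%VS,
        m = <<[seq e`_i | i <- iota 1 n.+1]>>%VS
      & [/\ (2 <= n)%N ->
              presented_by (fun i : 'I_n => e`_i.+1) (@quadratic_rels K n),
            n = 1%N ->
              presented_by (fun i : 'I_n => e`_i.+1) (@cubic_rels K n)
          & \matrix_(i < n.+2, j < n.+2) F e`_i e`_j = standard_form_mx K n]].
Proof.
have nz2 : (2%:R : K) != 0 by have := charK0 2; rewrite !inE /= => ->.
have [s [ms F1s Fss mulW Ws]] :=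
  socle_generator nz2 R_comm localR F_nondeg F11 W_hyper W_gen F_inv.
have F1W := invariant_form_hyperplane nz2 F_inv.
have F_eq0 x :=
  orthogonal_generators_eq0 nz2 R_comm localR F_nondeg F11 W_hyper W_gen F_inv
    s x ms F1s.
have m_dec :=
  maximal_decomposition nz2 R_comm localR F_nondeg F11 W_hyper W_gen F_inv
    s ms F1s.
have fullE := fullv_add1_maximal R_comm localR W_hyper W_gen.
have FW1 a : a \in W -> F a 1 = 0 by move=> Wa; rewrite symmetric_formC F1W.
have FWs a : a \in W -> F a s = 0.
  by move=> Wa; rewrite (invariant_formE F_inv) // Ws // linear0r oppr0.
(* Elements of [W] are already orthogonal to 1 and [s], so one that is also orthogonal to [W] is
   0. *)
have W_nondeg : (W :&: orthov F W)%VS = 0%VS.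
  apply/eqP; rewrite -subv0; apply/subvP => x; rewrite memv_cap memv0.
  by case/andP=> Wx /mem_orthovP FxW; apply/eqP/F_eq0; rewrite ?FW1 ?FWs.
have nzN1 : (-1 : K) != 0 by rewrite oppr_eq0 oner_eq0.
have [es bes Fes] := orthogonal_basis_exists K R F W (-1) nz2 nzN1 W_nondeg.
have dimW : \dim W = n.
  apply: succn_inj; rewrite (proj2 W_hyper); apply: succn_inj.
  by rewrite -(dim_fullv_maximal R_comm localR W_hyper W_gen) dimR.
have Wspan : W = <<es>>%VS by case/andP: bes => /eqP.
have sz_es : size es = n by rewrite -dimW Wspan; case/andP: bes => _ /eqP.
have Wes i : (i < n)%N -> es`_i \in W.
  by move=> lti; rewrite Wspan memv_span // mem_nth // sz_es.
have Fee i j : (i < n)%N -> (j < n)%N -> F es`_i es`_j = -1 *+ (i == j).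
  by move=> lti ltj; apply: Fes; rewrite inE sz_es.
have sz_e : size (1 :: rcons es s) == n.+2 by rewrite /= size_rcons sz_es.
exists (Tuple sz_e).
have nth_es i : (i < n)%N -> (1 :: rcons es s)`_i.+1 = es`_i.
  by move=> lti; rewrite /= nth_rcons sz_es lti.
have nth_s : (1 :: rcons es s)`_n.+1 = s.
  by rewrite /= nth_rcons sz_es ltnn eqxx.
have span_m : <<rcons es s>>%VS = m.
  by rewrite -cats1 span_cat span_seq1 -Wspan -m_dec.
(* Ordinals start at 0, so [e i] is the basis vector of index [i.+1]. *)
pose e (i : 'I_n) := (1 :: rcons es s)`_i.+1.
have We i : e i \in W by rewrite /e nth_es // Wes.
have Fe i j : F (e i) (e j) = -1 *+ (i == j) by rewrite /e !nth_es // Fee.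
(* The norm -1 of the basis vectors cancels the sign in [mulW]. *)
have mulee i j : e i * e j = s *+ (i == j).
  by rewrite mulW // Fe; case: eqP; rewrite ?opprK ?oppr0 ?scale1r ?scale0r.
(* The difference [d] of the two sides is checked to be orthogonal to 1, to [W] and to [s]. *)
have F_expand x : x = F x s *: 1 - \sum_i F x (e i) *: e i + F x 1 *: s.
  apply/eqP; rewrite -subr_eq0; set d := x - _.
  have FdE y : F d y = F x y - F x s * F 1 y
      + \sum_i F x (e i) * F (e i) y - F x 1 * F s y.
    rewrite /d linearBl linearDl linearBl /= !linearZl_LR /= linear_sumlz /=.
    under eq_bigr do rewrite linearZl_LR /=.
    by ring.
  have sumF0 y : (forall i, F (e i) y = 0) ->
      \sum_i F x (e i) * F (e i) y = 0.
    by move=> Fey; apply: big1 => i _; rewrite Fey mulr0.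
  apply/eqP/F_eq0.
  - rewrite FdE F11 (symmetric_formC _ s) F1s sumF0 => [|i]; last exact: FW1.
    by ring.
  - apply/mem_orthovP; rewrite mem_orthov_sym Wspan; apply/span_subvP => a.
    move=> /(nthP 0)[j]; rewrite sz_es => ltj <-.
    have -> : es`_j = e (Ordinal ltj) by rewrite /e nth_es.
    rewrite mem_orthov1 symmetric_formC FdE F1W //.
    rewrite (symmetric_formC _ s) (FWs (e _)) //.
    rewrite (bigD1 (Ordinal ltj)) //= Fe eqxx big1 => [|i /negPf neij].
      by rewrite mulr1n; apply/eqP; ring.
    by rewrite Fe neij mulr0.
  - rewrite FdE F1s Fss sumF0 => [|i]; last exact: FWs.
    by ring.
(* Any square ['X_i0 ^+ 2] can represent [s], since [e i0 * e i0 = s]. *)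
have presented (rels : {mpoly K[n]} -> Prop) (i0 : 'I_n) :
  (forall p, rels p -> poly_eval e p = 0) ->
  (forall i j : 'I_n,
     ideal_generated rels ('X_i * 'X_j - 'X_i0 ^+ 2 *+ (i == j))) ->
  (forall i : 'I_n, ideal_generated rels ('X_i * 'X_i0 ^+ 2)) ->
  presented_by e rels.
  move=> rels0 IXX IXP.
  apply: (presented_by_quadric R_comm F e s) rels0 IXX IXP => //.
  - by move=> i x y; apply: F_inv.
  - by move=> i; apply: Ws.
  - by move=> i; apply: F1W.
  by rewrite expr2 poly_evalM // poly_evalX mulee eqxx.
split=> //.
- rewrite basisEdim /= dimR size_rcons sz_es leqnn andbT.
  by rewrite span_cons span_m fullE.
- rewrite map_nth_iota ?(eqP sz_e) //=. 
  by rewrite drop0 -cats1 -sz_es take_size_cat.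
- rewrite map_nth_iota ?(eqP sz_e) //=. 
  by rewrite drop0 take_oversize ?span_m // size_rcons sz_es.
split.
(* The second index [i1] serves as the auxiliary variable in the cube computation. *)
- move=> n2; pose i0 := Ordinal (ltnW n2); pose i1 := Ordinal n2.
  apply: (presented _ i0) => [_ [i [j [ltij [->|->]]]]|i j|i].
  + by rewrite linearB /= !expr2 !poly_evalM // !poly_evalX !mulee !eqxx subrr.
  + rewrite poly_evalM // !poly_evalX mulee -val_eqE /=.
    by rewrite ltn_eqF.
  + have [->|] := eqVneq i j; first exact: quadratic_relsB.
    by rewrite subr0; apply: quadratic_relsM.
  + exact: (quadratic_rels_cube i i0 i1).
(* With a single variable all indices coincide: the quadratic congruences are trivial and the cubic
   one is the given relation. *)
- move=> n1; have ord_eq0 (i : 'I_n) : i = 0%N :> nat.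
    by apply/eqP; rewrite -leqn0 -ltnS -n1.
  have ord_eq (i j : 'I_n) : i = j by apply: val_inj; rewrite /= !ord_eq0.
  have lt0n : (0 < n)%N by rewrite n1.
  apply: (presented _ (Ordinal lt0n)) => [_ [i ->]|i j|i].
  + rewrite exprS expr2 !poly_evalM // !poly_evalX mulee eqxx.
    by rewrite Ws.
  + rewrite (ord_eq i j) (ord_eq (Ordinal lt0n) j) eqxx -expr2 subrr.
    exact: ideal_generated0.
  + rewrite (ord_eq (Ordinal lt0n) i) -exprS.
    by apply: ideal_generated_mem; exists i.
(* Each matrix index is the first, a middle or the last one, which gives nine blocks. *)
- have caseP k : (k < n.+2)%N ->
    [\/ k = 0%N, exists2 l, (l < n)%N & k = l.+1 | k = n.+1].
    case: k => [|k]; first by constructor 1.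
    rewrite !ltnS leq_eqVlt => /orP[/eqP ->|ltk]; first by constructor 3.
    by constructor 2; exists k.
  apply/matrixP => -[i lti] [j ltj]; rewrite !mxE -!val_eqE [val _]/= /=.
  case: (caseP i lti) (caseP j ltj) => [->|[k ltk ->]|->] [->|[l ltl ->]|->].
  + by rewrite F11.
  + by rewrite nth_es // F1W ?Wes //= eqSS (ltn_eqF ltl).
  + by rewrite nth_s F1s /= eqxx.
  + by rewrite nth_es // FW1 ?Wes //= andbT eqSS (ltn_eqF ltk).
  + rewrite !nth_es // Fee //= andbF !eqSS ltnS ltk andbT.
    by case: eqP.
  + by rewrite (nth_es k) // nth_s FWs ?Wes //= andbF !eqSS (ltn_eqF ltk).
  + by rewrite nth_s symmetric_formC F1s /= eqxx.
  + rewrite (nth_es l) // nth_s symmetric_formC FWs ?Wes //=.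
    by rewrite andbF ltnn !andbF.
  + by rewrite nth_s Fss /= andbF ltnn !andbF.
Qed.
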